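(* Let $W$ be a channel from a finite set $\mathcal X$ to a finite set $\mathcal Y$, let $p$ be a probability distribution on $\mathcal X$, and let $R$ be a real number. Then $$e_\epsilon(R|W,p)\ge\max_{0\le s\le1}\frac{-\psi(s|W,p)+sR}{1+s},\qquad e_D(R|W,p)\ge\max_{-1/2\le t\le0}\{-\phi(t|W,p)-tR\},$$ $$e_\epsilon(R|W)\ge\max_{0\le s\le1}\frac{-\psi(s|W)+sR}{1+s},\qquad e_D(R|W)\ge\max_{-1/2\le t\le0}\{-\max_p\phi(t|W,p)-tR\}.$$
   Context: A channel $W$ assigns to each $x\in\mathcal X$ a distribution $W_x$ on $\mathcal Y$; $W_p(y)=\sum_xp(x)W_x(y)$. Its $n$-fold memoryless extension is $W^n_{x^n}(y^n)=\prod_iW_{x_i}(y_i)$, and $p^n$ is the $n$-fold product of $p$. A resolvability code $\Psi$ of size $|\Psi|=M$ for a channel $V$ is a tuple $(x_1,\dots,x_M)$ of inputs; $\epsilon(\Psi,V_q):=\sum_y|\frac1M\sum_iV_{x_i}(y)-V_q(y)|$ and $D(\Psi,V_q):=D(\frac1M\sum_iV_{x_i}\|V_q)$ with $D(a\|b)=\sum a\log(a/b)$. For real $M>0$, $\epsilon(M,V):=\max_q\min_{\Psi:|\Psi|\le M}\epsilon(\Psi,V_q)$ and $D(M,V):=\max_q\min_{\Psi:|\Psi|\le M}D(\Psi,V_q)$, maxima over all input distributions $q$. Exponents: $e_\epsilon(R|W,p):=\sup\{\liminf_n-\frac1n\log\epsilon(\Psi_n,W^n_{p^n})\}$ and $e_D(R|W,p):=\sup\{\liminf_n-\frac1n\log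 D(\Psi_n,W^n_{p^n})\}$, suprema over sequences $\{\Psi_n\}$ of resolvability codes for $W^n$ with $\limsup_n\frac1n\log|\Psi_n|\le R$; $e_\epsilon(R|W):=\liminf_n-\frac1n\log\epsilon(e^{nR},W^n)$ and $e_D(R|W):=\liminf_n-\frac1n\log D(e^{nR},W^n)$. Functions: $\phi(t|W,p):=\log\sum_y\big(\sum_xp(x)W_x(y)^{1/(1+t)}\big)^{1+t}$; $\psi(s|W,p):=\log\sum_xp(x)\sum_yW_x(y)^{1+s}W_p(y)^{-s}$; $\psi(s|W):=\log\max_p\sum_y\big(\sum_xp(x)W_x(y)^{1+s}\big)^{1-s}$.
   Formalization: The formal theorem assumes R ≥ 0: for R < 0 no code sequence has limsup (1/n) log|Ψ_n| ≤ R and no code has size ≤ e^{nR} < 1, so the exponents are suprema or minima over empty sets while the right-hand sides are ≥ 0. *)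

(* Defs.v *)
From HB Require Import structures.
From mathcomp Require Import all_boot all_order all_algebra.
From mathcomp Require Import all_classical all_reals all_analysis.
Unset Printing Implicit Defensive.
Import Order.TTheory GRing.Theory Num.Theory.
Local Open Scope classical_set_scope.
Local Open Scope ring_scope.

Section ResolvabilityDefs.
Context {R : realType}.

Definition is_dist {A : finType} (p : A -> R) : Prop :=
  (forall a, 0 <= p a) /\ \sum_a p a = 1.

Definition is_channel {A B : finType} (W : A -> B -> R) : Prop :=
  forall a, is_dist (W a).

Definition out_dist {A B : finType} (W : A -> B -> R) (p : A -> R) : B -> R :=
  fun b => \sum_a p a * W a b.

Definition ext_chan {A B : finType} (W : A -> B -> R) (n : nat) :
  {ffun 'I_n -> A} -> {ffun 'I_n -> B} -> R :=
  fun x y => \prod_(i < n) W (x i) (y i).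

Definition ext_dist {A : finType} (p : A -> R) (n : nat) : {ffun 'I_n -> A} -> R :=
  fun x => \prod_(i < n) p (x i).

(* resolvability code = tuple (sequence) of inputs; its output distribution *)
Definition code_out {A B : finType} (V : A -> B -> R) (c : seq A) : B -> R :=
  fun b => (size c)%:R^-1 * \sum_(a <- c) V a b.

Definition KL {B : finType} (a b : B -> R) : \bar R :=
  if [exists y, (a y != 0) && (b y == 0)] then +oo%E
  else (\sum_y (if a y == 0 then 0 else a y * ln (a y / b y)))%:E.

Definition eps_code {A B : finType} (V : A -> B -> R) (q : A -> R) (c : seq A) : R :=
  \sum_b `|code_out V c b - out_dist V q b|.

Definition D_code {A B : finType} (V : A -> B -> R) (q : A -> R) (c : seq A) : \bar R :=
  KL (code_out V c) (out_dist V q).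

Definition neglog (x : \bar R) : \bar R :=
  match x with
  | EFin r => if r <= 0 then +oo%E else (- ln r)%:E
  | +oo%E => -oo%E
  | -oo%E => +oo%E
  end.

Definition codes_le (A : finType) (M : R) : set (seq A) :=
  [set c | (0 < size c)%N /\ (size c)%:R <= M].

(* eps(M,V) = max_q min_{|Psi| <= M} eps(Psi, V_q)  (max/min taken as sup/inf) *)
Definition eps_M {A B : finType} (V : A -> B -> R) (M : R) : \bar R :=
  ereal_sup [set ereal_inf [set (eps_code V q c)%:E | c in @codes_le A M]
            | q in [set q : A -> R | is_dist q]].

Definition D_M {A B : finType} (V : A -> B -> R) (M : R) : \bar R :=
  ereal_sup [set ereal_inf [set D_code V q c | c in @codes_le A M]
            | q in [set q : A -> R | is_dist q]].

Definition rate_ok {X : finType} (c : forall n : nat, seq {ffun 'I_n -> X}) (r : R) : Prop :=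
  (forall n, (0 < size (c n))%N) /\
  (limn_esup (fun n : nat => (n%:R^-1 * ln (size (c n))%:R)%:E) <= r%:E)%E.

Definition e_eps_p {X Y : finType} (W : X -> Y -> R) (p : X -> R) (r : R) : \bar R :=
  ereal_sup [set e | exists c : forall n : nat, seq {ffun 'I_n -> X},
    rate_ok c r /\
    e = limn_einf (fun n : nat =>
          ((n%:R^-1)%:E * neglog (eps_code (ext_chan W n) (ext_dist p n) (c n))%:E)%E)].

Definition e_D_p {X Y : finType} (W : X -> Y -> R) (p : X -> R) (r : R) : \bar R :=
  ereal_sup [set e | exists c : forall n : nat, seq {ffun 'I_n -> X},
    rate_ok c r /\
    e = limn_einf (fun n : nat =>
          ((n%:R^-1)%:E * neglog (D_code (ext_chan W n) (ext_dist p n) (c n)))%E)].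

Definition e_eps {X Y : finType} (W : X -> Y -> R) (r : R) : \bar R :=
  limn_einf (fun n : nat =>
    ((n%:R^-1)%:E * neglog (eps_M (ext_chan W n) (expR (n%:R * r))))%E).

Definition e_D {X Y : finType} (W : X -> Y -> R) (r : R) : \bar R :=
  limn_einf (fun n : nat =>
    ((n%:R^-1)%:E * neglog (D_M (ext_chan W n) (expR (n%:R * r))))%E).

Definition phi {X Y : finType} (t : R) (W : X -> Y -> R) (p : X -> R) : R :=
  ln (\sum_y powR (\sum_x p x * powR (W x y) (1 + t)^-1) (1 + t)).

Definition psi_p {X Y : finType} (s : R) (W : X -> Y -> R) (p : X -> R) : R :=
  ln (\sum_x p x * \sum_y powR (W x y) (1 + s) * powR (out_dist W p y) (- s)).

(* max over input distributions taken as sup *)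
Definition psi {X Y : finType} (s : R) (W : X -> Y -> R) : R :=
  ln (sup [set \sum_y powR (\sum_x p x * powR (W x y) (1 + s)) (1 - s)
          | p in [set p : X -> R | is_dist p]]).

Definition max_phi {X Y : finType} (t : R) (W : X -> Y -> R) : R :=
  sup [set phi t W p | p in [set p : X -> R | is_dist p]].

End ResolvabilityDefs.

(* Main.v *)
Require Import Defs.
From HB Require Import structures.
From mathcomp Require Import all_boot all_order all_algebra.
From mathcomp Require Import all_classical all_reals all_analysis.
From mathcomp Require Import ring lra.
Import Order.TTheory GRing.Theory Num.Theory.
Local Open Scope classical_set_scope.
Local Open Scope ring_scope.

(** Random coding. Draw the [M] code words independently from [q] and write
    [Q = V_q] and [Psi = sum_(x, y) q x * V_x(y)^(1+s) * Q(y)^(-s)].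

    For the variational distance, truncate [V_x(y)] at a level depending on [y];
    the variance of the bounded part and the mean of the tail give an expected
    distance of at most [3 * (Psi / M^s)^(1/(1+s))] after Hoelder over [y]. For
    the divergence, Jensen conditionally on one code word and
    [ln (1 + u) <= u^s / s] give an expected divergence of at most
    [Psi / (s * M^s)].

    [Psi] is multiplicative for product inputs. It is dominated both by
    [sum_y (sum_x q x * V_x(y)^(1/(1-s)))^(1-s)] (Hoelder) and by
    [sum_y (sum_x q x * V_x(y)^(1+s))^(1-s)], whose suprema over all inputs of
    [W^n] are at most the [n]-th powers of the single-letter ones. The first sum
    is at most [|Y|^s], which settles [t = 0] by letting [s] tend to [0]. *)

(** * Elementary inequalities for real powers and logarithms *)

Section PowerInequalities.
Context {R : realType}.
Implicit Types (s u th x y : R).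

Lemma powR_le u x y : 0 <= u -> 0 <= x -> x <= y -> x `^ u <= y `^ u.
Proof.
move=> u0 x0 xy; apply: ge0_ler_powR => //; rewrite nnegrE //.
exact: le_trans xy.
Qed.

Lemma powR_prod (I : finType) (f : I -> R) u :
  (forall i, 0 <= f i) -> (\prod_i f i) `^ u = \prod_i f i `^ u.
Proof.
(* Nonnegativity of the partial products is carried along, since [powRM] asks for it at each
   step. *)
move=> f0; suff [] : (\prod_i f i) `^ u = \prod_i f i `^ u /\ 0 <= \prod_i f i by [].
elim/big_ind2: _ => //=.
- by rewrite powR1.
- by move=> x1 x2 y1 y2 [<- ?] [<- ?]; rewrite powRM// mulr_ge0.
Qed.

(** Young's inequality for the conjugate exponents [th^-1] and [(1 - th)^-1]. *)
Lemma powR_weighted_AMGM th x y : 0 < th < 1 -> 0 <= x -> 0 <= y ->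
  x `^ th * y `^ (1 - th) <= th * x + (1 - th) * y.
Proof.
move=> /andP[t0 t1] x0 y0.
have t1' : 0 < 1 - th by rewrite subr_gt0.
have := @conjugate_powR R (x `^ th) (y `^ (1 - th)) th^-1 (1 - th)^-1
  (powR_ge0 _ _) (powR_ge0 _ _).
rewrite !invr_gt0 !invrK -!powRrM !mulfV ?gt_eqF// !powRr1// [x * _]mulrC [y * _]mulrC.
by apply => //; lra.
Qed.

(** After both families are scaled to sum 1, weighted AM-GM bounds the left side termwise, with
    total [th + (1 - th)]. A zero sum cannot be scaled, but then all terms vanish. *)
Lemma sum_hoelder (I : finType) (u v : I -> R) th : 0 < th <= 1 ->
  (forall i, 0 <= u i) -> (forall i, 0 <= v i) ->
  \sum_i u i `^ th * v i `^ (1 - th) <= (\sum_i u i) `^ th * (\sum_i v i) `^ (1 - th).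
Proof.
move=> /andP[t0 t1] u0 v0.
have := t1; rewrite le_eqVlt => /predU1P[->|tlt].
  rewrite subrr powRr0 mulr1 powRr1 ?sumr_ge0//.
  by apply: ler_sum => i _; rewrite powRr0 mulr1 powRr1.
have tp : 0 < 1 - th by rewrite subr_gt0.
have Su0 : 0 <= \sum_i u i by exact: sumr_ge0.
have Sv0 : 0 <= \sum_i v i by exact: sumr_ge0.
have [Su|Su] := eqVneq (\sum_i u i) 0.
  rewrite big1 ?mulr_ge0 ?powR_ge0// => i _.
  by rewrite (psumr_eq0P _ Su)// powR0 ?mul0r// gt_eqF.
have [Sv|Sv] := eqVneq (\sum_i v i) 0.
  rewrite big1 ?mulr_ge0 ?powR_ge0// => i _.
  by rewrite (psumr_eq0P _ Sv)// powR0 ?mulr0// gt_eqF.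
set U := \sum_i u i in Su Su0 *; set V := \sum_i v i in Sv Sv0 *.
have Ugt0 : 0 < U by rewrite lt0r Su.
have Vgt0 : 0 < V by rewrite lt0r Sv.
have -> : \sum_i u i `^ th * v i `^ (1 - th) =
    U `^ th * V `^ (1 - th) * \sum_i (u i / U) `^ th * (v i / V) `^ (1 - th).
  rewrite mulr_sumr; apply: eq_bigr => i _.
  rewrite mulrACA -!powRM ?divr_ge0//.
  by rewrite !(mulrC U) !(mulrC V) !divfK.
rewrite ler_piMr ?mulr_ge0 ?powR_ge0//.
apply: (@le_trans _ _ (\sum_i (th * (u i / U) + (1 - th) * (v i / V)))).
  by apply: ler_sum => i _; apply: powR_weighted_AMGM; rewrite ?divr_ge0 ?t0.
rewrite big_split/= -!mulr_sumr -!mulr_suml -/U -/V !divff//; lra.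
Qed.

Lemma ln1D_le_powR s u : 0 < s <= 1 -> 0 <= u -> ln (1 + u) <= s^-1 * u `^ s.
Proof.
move=> /andP[s0 s1] u0.
have h : 0 < 1 + u by lra.
rewrite -ler_pdivrMl ?invr_gt0// invrK -ln_powR.
have pow_le x : 0 <= x <= 1 -> x <= x `^ s.
  move=> /andP[x0 x1]; have [->|xn0] := eqVneq x 0; first by rewrite powR_ge0.
  by rewrite ger1_powR// x1 lt0r xn0 x0.
(* Subadditivity of the power: the fractions [1 / (1 + u)] and [u / (1 + u)] sum to 1, and each is
   at most its own [s]-th power. *)
have sub : (1 + u) `^ s <= 1 + u `^ s.
  have a1 := pow_le (1 / (1 + u)); have a2 := pow_le (u / (1 + u)).
  have : 1 / (1 + u) + u / (1 + u) = 1 by rewrite -mulrDl divff ?gt_eqF.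
  have p0 := powR_gt0 s h.
  have e1 : (1 / (1 + u)) `^ s = 1 / (1 + u) `^ s.
    by rewrite powRM ?invr_ge0 ?(ltW h)// -powR_inv1 ?(ltW h)// -powRrM mulN1r powRN powR1.
  have e2 : (u / (1 + u)) `^ s = u `^ s / (1 + u) `^ s.
    by rewrite powRM ?invr_ge0 ?(ltW h)// -powR_inv1 ?(ltW h)// -powRrM mulN1r powRN.
  rewrite e1 in a1; rewrite e2 in a2 => e.
  rewrite -[leLHS]mul1r -ler_pdivlMr// mulrDl -[leLHS]e.
  apply: lerD; [apply: a1|apply: a2];
    by rewrite divr_ge0 ?ler01 ?(ltW h)//= ler_pdivrMr// ; lra.
apply: (@le_trans _ _ (ln (1 + u `^ s))).
  by rewrite ler_ln// posrE ?powR_gt0// ltr_pwDl// powR_ge0.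
by apply: le_ln1Dx; have := powR_ge0 u s; lra.
Qed.

Lemma le_expR_ln x : x <= expR (ln x).
Proof.
have [x0|x0] := ltP 0 x; first by rewrite lnK// posrE.
exact: le_trans (expR_ge0 _).
Qed.

End PowerInequalities.

(** * Expectations over independent code words *)

Section RandomCode.
Context {R : realType} {A : finType}.
Variables (q : A -> R) (M : nat).
Hypothesis qd : is_dist q.

Let q0 a : 0 <= q a. Proof. exact: qd.1. Qed.
Let q1 : \sum_a q a = 1. Proof. exact: qd.2. Qed.

Local Notation w := (@ext_dist R A q M).

(** [ext_dist] serves both as a product input of the extended channel and, here, as the joint law of
    [M] independent code words. *)
Definition expect (F : {ffun 'I_M -> A} -> R) : R := \sum_c w c * F c.

Lemma ext_dist_ge0 c : 0 <= w c.
Proof. by apply: prodr_ge0. Qed.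

Lemma expect_prod (F : 'I_M -> A -> R) :
  expect (fun c => \prod_i F i (c i)) = \prod_i \sum_a q a * F i a.
Proof.
rewrite bigA_distr_bigA/=; apply: eq_bigr => c _.
by rewrite /ext_dist -big_split.
Qed.

Lemma expect_cst x : expect (fun=> x) = x.
Proof.
rewrite /expect -mulr_suml.
suff -> : \sum_c w c = 1 by rewrite mul1r.
rewrite /ext_dist -(bigA_distr_bigA (fun (_ : 'I_M) a => q a)).
by rewrite big1.
Qed.

Lemma is_dist_ext_dist : is_dist w.
Proof.
split; first exact: ext_dist_ge0.
by rewrite -(expect_cst 1) /expect; apply: eq_bigr => c _; rewrite mulr1.
Qed.

Lemma expectD F G : expect (fun c => F c + G c) = expect F + expect G.
Proof. by rewrite /expect -big_split; apply: eq_bigr => c _; rewrite mulrDr. Qed.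

Lemma expectZ x F : expect (fun c => x * F c) = x * expect F.
Proof. by rewrite /expect mulr_sumr; apply: eq_bigr => c _; rewrite mulrCA. Qed.

Lemma expect_sum (I : finType) (P : pred I) (F : I -> _ -> R) :
  expect (fun c => \sum_(i | P i) F i c) = \sum_(i | P i) expect (F i).
Proof.
rewrite /expect exchange_big/=; apply: eq_bigr => c _.
by rewrite mulr_sumr.
Qed.

Lemma eq_expect F G : F =1 G -> expect F = expect G.
Proof. by move=> FG; apply: eq_bigr => c _; rewrite FG. Qed.

Lemma le_expect F G : (forall c, 0 < w c -> F c <= G c) -> expect F <= expect G.
Proof.
move=> FG; apply: ler_sum => c _.
have := ext_dist_ge0 c; rewrite le_eqVlt => /predU1P[<-|h]; first by rewrite !mul0r.
by rewrite ler_pM2l// FG.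
Qed.

Lemma expect_coord i (g : A -> R) : expect (fun c => g (c i)) = \sum_a q a * g a.
Proof.
have := expect_prod (fun k a => if k == i then g a else 1).
rewrite [RHS](bigD1 i)//= eqxx [X in _ * X]big1 ?mulr1.
  move=> <-; apply: eq_expect => c.
  by rewrite (bigD1 i)//= eqxx big1 ?mulr1// => k /negbTE ->.
by move=> k /negbTE ->; under eq_bigr do rewrite mulr1.
Qed.

Lemma expect_coord2 i j (g h : A -> R) : i != j ->
  expect (fun c => g (c i) * h (c j)) = (\sum_a q a * g a) * (\sum_a q a * h a).
Proof.
move=> ij; have ji : (j == i) = false by rewrite eq_sym (negbTE ij).
have := expect_prod (fun k a => if k == i then g a else if k == j then h a else 1).
rewrite [RHS](bigD1 i)//= eqxx (bigD1 j)/=; last by rewrite ji.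
rewrite ji eqxx [X in _ * (_ * X)]big1 ?mulr1.
  move=> <-; apply: eq_expect => c.
  rewrite (bigD1 i)//= eqxx (bigD1 j)/= ?ji// eqxx big1 ?mulr1//.
  by move=> k /andP[/negbTE -> /negbTE ->].
by move=> k /andP[/negbTE -> /negbTE ->]; under eq_bigr do rewrite mulr1.
Qed.

(** Derandomization: otherwise [F c - expect F] would be positive wherever [w c] is, yet its mean is
    zero. Positivity of [w c] is recorded because it puts every code word in the support of [q],
    which keeps the divergence finite. *)
Lemma expect_attained F : exists2 c, 0 < w c & F c <= expect F.
Proof.
apply: contrapT => /forallPNP H.
have pos c : 0 <= w c * (F c - expect F).
  have := ext_dist_ge0 c; rewrite le_eqVlt => /predU1P[<-|h]; first by rewrite mul0r.
  by rewrite mulr_ge0 ?(ltW h)// subr_ge0 leNgt; apply/negP => /ltW; exact: H.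
have zero : \sum_c w c * (F c - expect F) = 0.
  have := expectD F (fun=> - expect F).
  by rewrite expect_cst subrr.
have [c wc] : exists c, 0 < w c.
  apply: contrapT => /forallNP h.
  have := is_dist_ext_dist.2; rewrite big1 => [/eqP|c _]; first by rewrite eq_sym oner_eq0.
  by apply/eqP; rewrite eq_le ext_dist_ge0 leNgt andbT; apply/negP; exact: h.
apply: (H c wc).
have := psumr_eq0P (fun c _ => pos c) zero (i := c) isT.
by move/eqP; rewrite mulf_eq0 gt_eqF//= subr_eq0 => /eqP ->.
Qed.

(** This is nonnegativity of the variance of [|F|]. *)
Lemma expect_norm_le F (x : R) : 0 <= x -> expect (fun c => F c ^+ 2) <= x ^+ 2 ->
  expect (fun c => `|F c|) <= x.
Proof.
move=> x0 F2; set m := expect _.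
have m0 : 0 <= m by apply: sumr_ge0 => c _; rewrite mulr_ge0 ?ext_dist_ge0.
rewrite -(@ler_pXn2r _ 2)//; apply: le_trans F2.
rewrite -subr_ge0.
have -> : expect (fun c => F c ^+ 2) - m ^+ 2 = expect (fun c => (`|F c| - m) ^+ 2).
  have -> : expect (fun c => (`|F c| - m) ^+ 2) =
      expect (fun c => (F c ^+ 2 + m ^+ 2) + (- (m *+ 2)) * `|F c|).
    apply: eq_expect => c; rewrite -(real_normK (num_real (F c))); ring.
  rewrite expectD expectD expect_cst (expectZ (- (m *+ 2))) -/m; ring.
by apply: sumr_ge0 => c _; rewrite mulr_ge0 ?ext_dist_ge0// sqr_ge0.
Qed.

Definition avg (g : A -> R) (c : {ffun 'I_M -> A}) : R := M%:R^-1 * \sum_i g (c i).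

Lemma expect_avg g : (0 < M)%N -> expect (avg g) = \sum_a q a * g a.
Proof.
move=> M0; rewrite expectZ expect_sum.
under eq_bigr do rewrite expect_coord.
rewrite sumr_const card_ord -[X in _ * X]mulr_natl mulrA mulVf ?mul1r// pnatr_eq0.
by rewrite -lt0n.
Qed.

Lemma expect_avg_var g : (0 < M)%N ->
  expect (fun c => (avg g c - \sum_a q a * g a) ^+ 2)
    <= M%:R^-1 * \sum_a q a * g a ^+ 2.
Proof.
move=> M0; set mu := \sum_a q a * g a.
have Mn0 : M%:R != 0 :> R by rewrite pnatr_eq0 -lt0n.
pose u a := g a - mu.
have u0 : \sum_a q a * u a = 0.
  under eq_bigr do rewrite mulrBr.
  by rewrite sumrB -mulr_suml q1 mul1r subrr.
have -> : expect (fun c => (avg g c - mu) ^+ 2) =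
    M%:R^-1 ^+ 2 * \sum_i \sum_j expect (fun c => u (c i) * u (c j)).
  under eq_bigr do rewrite -expect_sum.
  rewrite -expect_sum -expectZ; apply: eq_expect => c.
  under eq_bigr do rewrite -mulr_sumr.
  rewrite -mulr_suml -expr2 -exprMn; congr (_ ^+ 2).
  by rewrite /u /avg sumrB sumr_const card_ord mulrBr -[mu *+ M]mulr_natl mulKf.
(* Distinct code words are independent and [u] has mean zero, so only the [M] diagonal terms
   survive. *)
have -> : \sum_i \sum_j expect (fun c => u (c i) * u (c j)) =
    M%:R * \sum_a q a * u a ^+ 2.
  under eq_bigr => i _.
    rewrite (bigD1 i)//= [X in _ + X]big1 ?addr0; last first.
      by move=> j ji; rewrite expect_coord2 1?eq_sym// u0 mul0r.
    rewrite (expect_coord i (fun a => u a * u a)).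
    over.
  by rewrite sumr_const card_ord mulr_natl; congr (_ *+ _).
rewrite expr2 -mulrA mulKf// ler_wpM2l ?invr_ge0//.
have -> : \sum_a q a * u a ^+ 2 = \sum_a q a * g a ^+ 2 - mu ^+ 2.
  have -> : \sum_a q a * u a ^+ 2 =
      \sum_a (q a * g a ^+ 2 + (- (mu *+ 2) * (q a * g a) + mu ^+ 2 * q a)).
    by apply: eq_bigr => a _; rewrite /u; ring.
  rewrite !big_split/= -!mulr_sumr q1 -/mu; ring.
by rewrite lerBlDr lerDl sqr_ge0.
Qed.

End RandomCode.

(** * Mean deviation of an empirical average *)

Section Deviation.
Context {R : realType} {A : finType}.

(* Truncation at the level [tau] where the second-moment bound of the bounded
   part and the first-moment bound of the tail coincide: both are [tau / M]. *)
Lemma expect_avg_dev (q : A -> R) (M : nat) (f : A -> R) (s : R) :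
  is_dist q -> (0 < M)%N -> 0 <= s <= 1 -> (forall a, 0 <= f a) ->
  expect q M (fun c => `|avg M f c - \sum_a q a * f a|) <=
  3 * ((M%:R * \sum_a q a * f a `^ (1 + s)) `^ (1 + s)^-1 / M%:R).
Proof.
move=> qd M0 /andP[s0 s1] f0.
set a := \sum_a q a * f a `^ (1 + s); set tau := _ `^ _.
have q0 := qd.1.
have MR0 : 0 < M%:R :> R by rewrite ltr0n.
have nz2 : (1 - s + (1 + s) == 0) = false by apply/eqP; lra.
have nz1 : (1 + s == 0) = false by apply/eqP; lra.
have e2 : 2%:R = 1 - s + (1 + s) by lra.
have a0 : 0 <= a by apply: sumr_ge0 => x _; rewrite mulr_ge0 ?powR_ge0.
have tau0 : 0 <= tau by exact: powR_ge0.
have taue : tau `^ (1 + s) = M%:R * a.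
  rewrite /tau -powRrM mulVf ?powRr1 ?mulr_ge0 ?(ltW MR0)//; rewrite gt_eqF//; lra.
pose g x := if f x <= tau then f x else 0.
pose h x := f x - g x.
have g0 x : 0 <= g x by rewrite /g; case: ifP.
have h0 x : 0 <= h x by rewrite /h /g; case: ifP => _; rewrite ?subrr// subr0.
(* Below the level, [f^2 <= tau^(1-s) * f^(1+s)]; then [tau^(1+s) = M * a] is substituted. *)
have Eg2 : \sum_x q x * g x ^+ 2 <= tau ^+ 2 / M%:R.
  apply: (@le_trans _ _ (tau `^ (1 - s) * a)).
    rewrite /a mulr_sumr; apply: ler_sum => x _; rewrite [leRHS]mulrCA ler_wpM2l//.
    rewrite /g; case: ifP => [ft|_]; last by rewrite expr0n/= mulr_ge0 ?powR_ge0.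
    rewrite -(powR_mulrn 2 (f0 x)) e2 powRD ?nz2//.
    by rewrite ler_wpM2r ?powR_ge0// powR_le// subr_ge0.
  rewrite ler_pdivlMr// -mulrA [a * _]mulrC -taue -powRD ?nz2//.
  by rewrite -e2 powR_mulrn.
(* Above the level, [tau^s * f <= f^(1+s)]. When [tau = 0] one cannot divide by [tau^s], but then
   [a = 0] and every [q x * h x] vanishes. *)
have Eh : \sum_x q x * h x <= tau / M%:R.
  have [t0|tn0] := eqVneq tau 0.
    have aeq0 : a = 0.
      move: taue; rewrite t0 powR0; last by rewrite gt_eqF//; lra.
      by move=> /esym/eqP; rewrite mulf_eq0 (gt_eqF MR0)/= => /eqP.
    rewrite t0 mul0r big1// => x _.
    have := psumr_eq0P _ aeq0 (i := x) isT => /(_ _)/eqP.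
    rewrite mulf_eq0 powR_eq0 => /(_ (fun i _ => mulr_ge0 (q0 i) (powR_ge0 _ _))).
    move=> /orP[/eqP ->|/andP[/eqP fx _]]; first by rewrite mul0r.
    by rewrite /h /g fx tau0 subrr mulr0.
  have tp : 0 < tau by rewrite lt0r tn0.
  rewrite -(ler_pM2l (powR_gt0 s tp)).
  have -> : tau `^ s * (tau / M%:R) = a.
    rewrite mulrA -{2}(powRr1 tau0) -powRD; last by rewrite tn0 implybT.
    by rewrite addrC taue mulrAC mulfV ?mul1r// gt_eqF.
  rewrite /a mulr_sumr; apply: ler_sum => x _; rewrite mulrCA ler_wpM2l//.
  rewrite /h /g; case: ifPn => [_|]; first by rewrite subrr mulr0 powR_ge0.
  rewrite -ltNge subr0 => tf.
  by rewrite powRD ?nz1// powRr1// mulrC ler_wpM2l// powR_le// ltW.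
(* The tail [h] is nonnegative, so its deviation is at most its average plus its mean. This
   contributes [2 * tau / M], and the bounded part [tau / M]: hence the factor 3. *)
apply: (@le_trans _ _ (expect q M (fun c => `|avg M g c - \sum_a q a * g a|
     + (avg M h c + \sum_a q a * h a)))).
  apply: le_expect => // c _.
  have avg0 : 0 <= avg M h c.
    by rewrite /avg mulr_ge0 ?invr_ge0// sumr_ge0.
  have Eh0 : 0 <= \sum_a q a * h a by rewrite sumr_ge0// => x _; rewrite mulr_ge0.
  have -> : avg M f c = avg M g c + avg M h c.
    rewrite /avg -mulrDr -big_split; congr (_ * _); apply: eq_bigr => i _.
    by rewrite /= /h subrKC.
  have -> : \sum_a q a * f a = \sum_a q a * g a + \sum_a q a * h a.
    rewrite -big_split; apply: eq_bigr => i _.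
    by rewrite /= -mulrDr /h subrKC.
  rewrite opprD addrACA; apply: le_trans (ler_normD _ _) _; rewrite lerD2l.
  by apply: le_trans (ler_normB _ _) _; rewrite !ger0_norm.
rewrite expectD expectD expect_cst// expect_avg//.
have : expect q M (fun c => `|avg M g c - \sum_a q a * g a|) <= tau / M%:R.
  apply: expect_norm_le => //; first by rewrite divr_ge0 ?(ltW MR0).
  apply: le_trans (expect_avg_var _ _ qd _ M0) _.
  rewrite expr_div_n [leRHS]mulrC expr2 invfM -mulrA ler_pM2l ?invr_gt0//.
  by rewrite [leRHS]mulrC.
lra.
Qed.

End Deviation.

(** * One-shot bound for the variational distance *)

Section OneShot.
Context {R : realType} {A B : finType}.
Variables (V : A -> B -> R) (q : A -> R) (M : nat).
Hypotheses (Vc : is_channel V) (qd : is_dist q) (M0 : (0 < M)%N).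

(** The argument of the logarithm in [psi_p]: the exponential of [s] times the Renyi divergence of
    order [1 + s] between the joint law of input and output and the product of its marginals. *)
Definition Psi (s : R) : R :=
  \sum_x q x * \sum_y V x y `^ (1 + s) * out_dist V q y `^ (- s).

Let q0 a : 0 <= q a. Proof. exact: qd.1. Qed.
Let V0 a b : 0 <= V a b. Proof. exact: (Vc a).1. Qed.
Local Notation Q := (out_dist V q).

Lemma out_dist_ge0 b : 0 <= Q b.
Proof. by apply: sumr_ge0 => a _; rewrite mulr_ge0. Qed.

Lemma sum_out_dist : \sum_b Q b = 1.
Proof.
rewrite exchange_big/= -qd.2; apply: eq_bigr => a _.
by rewrite -mulr_sumr (Vc a).2 mulr1.
Qed.

Lemma out_dist_gt0 a b : 0 < q a -> 0 < V a b -> 0 < Q b.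
Proof.
move=> qa Vab; rewrite /out_dist (bigD1 a)//= ltr_pwDl ?mulr_gt0//.
by apply: sumr_ge0 => x _; rewrite mulr_ge0.
Qed.

Lemma PsiE s :
  Psi s = \sum_y (\sum_x q x * V x y `^ (1 + s)) * Q y `^ (- s).
Proof.
rewrite /Psi; under eq_bigr do rewrite mulr_sumr.
rewrite exchange_big/=; apply: eq_bigr => y _.
by rewrite mulr_suml; apply: eq_bigr => x _; rewrite mulrA.
Qed.

Lemma Psi_ge0 s : 0 <= Psi s.
Proof.
apply: sumr_ge0 => x _; rewrite mulr_ge0// sumr_ge0// => y _.
by rewrite mulr_ge0 ?powR_ge0.
Qed.

Lemma ext_dist_gt0_coord (c : {ffun 'I_M -> A}) i :
  0 < ext_dist q M c -> 0 < q (c i).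
Proof.
move=> wc; rewrite lt0r q0 andbT; apply/eqP => qi; move: wc.
by rewrite /ext_dist (bigD1 i)//= qi mul0r ltxx.
Qed.

Lemma code_out_codom (c : {ffun 'I_M -> A}) b :
  code_out V (codom c) b = avg M (V^~ b) c.
Proof. by rewrite /code_out size_codom card_ord big_image. Qed.

(** Hoelder over [y] with weights [th = 1/(1+s)] and [1 - th = s/(1+s)]: the factor [Q^(1-th)]
    cancels the power [Q^(-s*th)], and [Q] has total mass 1. *)
Lemma sum_power_le_Psi s : 0 <= s <= 1 ->
  \sum_y (\sum_x q x * V x y `^ (1 + s)) `^ (1 + s)^-1 <= Psi s `^ (1 + s)^-1.
Proof.
move=> /andP[s0 s1].
have sp : 0 < 1 + s by lra.
set th := (1 + s)^-1.
have th0 : 0 < th by rewrite invr_gt0.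
have ths : th * (1 + s) = 1 by rewrite mulVf// gt_eqF.
have th1 : th <= 1 by rewrite invf_le1//; lra.
have S0 y : 0 <= \sum_x q x * V x y `^ (1 + s).
  by rewrite sumr_ge0// => x _; rewrite mulr_ge0 ?powR_ge0.
apply: (@le_trans _ _ (\sum_y ((\sum_x q x * V x y `^ (1 + s)) * Q y `^ (- s)) `^ th
    * Q y `^ (1 - th))).
  apply: ler_sum => y _.
  (* Powers of [Q y] do not cancel at [Q y = 0], but there every [q x * V x y] is zero. *)
  have [Q0|Qn0] := eqVneq (Q y) 0.
    rewrite (_ : \sum_x _ = 0) ?powR0 ?gt_eqF//; first by rewrite mulr_ge0 ?powR_ge0.
    apply: big1 => x _.
    have /eqP := psumr_eq0P (fun i _ => mulr_ge0 (q0 i) (V0 i y)) Q0 (i := x) isT.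
    rewrite mulf_eq0 => /orP[/eqP ->|/eqP ->]; first by rewrite mul0r.
    by rewrite powR0 ?mulr0 ?gt_eqF.
  rewrite powRM ?powR_ge0// -mulrA -powRrM -powRD; last by rewrite Qn0 implybT.
  by rewrite (_ : - s * th + (1 - th) = 0) ?powRr0 ?mulr1//; lra.
have := @sum_hoelder _ _ (fun y => (\sum_x q x * V x y `^ (1 + s)) * Q y `^ (- s)) Q th.
rewrite th0 th1 sum_out_dist powR1 mulr1 -PsiE; apply => // y.
  by rewrite mulr_ge0 ?powR_ge0.
exact: out_dist_ge0.
Qed.

Lemma exists_code_eps s : 0 <= s <= 1 ->
  exists c : seq A, size c = M /\
    eps_code V q c <= 3 * (Psi s `^ (1 + s)^-1 * M%:R `^ (- (s / (1 + s)))).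
Proof.
move=> s01; have [s0 s1] := andP s01.
have MR0 : 0 < M%:R :> R by rewrite ltr0n.
have [c _ h] := expect_attained q M qd (fun c => eps_code V q (codom c)).
exists (codom c); split; first by rewrite size_codom card_ord.
apply: le_trans h _.
rewrite /eps_code expect_sum.
apply: (@le_trans _ _ (\sum_y 3 * ((M%:R * \sum_x q x * V x y `^ (1 + s)) `^ (1 + s)^-1 / M%:R))).
  apply: ler_sum => y _.
  apply: le_trans (expect_avg_dev q M (V^~ y) s qd M0 s01 (V0^~ y)).
  rewrite le_eqVlt; apply/orP; left; apply/eqP.
  by apply: eq_expect => d; rewrite code_out_codom.
rewrite -mulr_sumr ler_pM2l//.
have S0 y : 0 <= \sum_x q x * V x y `^ (1 + s).
  by rewrite sumr_ge0// => x _; rewrite mulr_ge0 ?powR_ge0.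
under eq_bigr => y _.
  rewrite powRM ?(ltW MR0)// mulrAC -[X in _ / X](powRr1 (ltW MR0)) -powRB; last first.
    by rewrite (gt_eqF MR0) implybT.
  over.
rewrite -mulr_sumr mulrC (_ : (1 + s)^-1 - 1 = - (s / (1 + s))); last by field; lra.
by rewrite ler_wpM2r ?powR_ge0// sum_power_le_Psi.
Qed.

End OneShot.

(** * One-shot bound for the divergence *)

Section OneShotDivergence.
Context {R : realType} {A B : finType}.
Variables (V : A -> B -> R) (q : A -> R) (M : nat).
Hypotheses (Vc : is_channel V) (qd : is_dist q) (M0 : (0 < M)%N).

Let q0 a : 0 <= q a. Proof. exact: qd.1. Qed.
Let V0 a b : 0 <= V a b. Proof. exact: (Vc a).1. Qed.
Let MR0 : 0 < M%:R :> R. Proof. by rewrite ltr0n. Qed.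
Let MV1 : M%:R^-1 <= 1 :> R. Proof. by rewrite invf_le1// ler1n. Qed.
Local Notation Q := (out_dist V q).

(* [cond_mean y a] is the conditional mean of the likelihood ratio of the code
   output at [y] given that one of its words is [a]. *)
Definition cond_mean y a := V a y / (M%:R * Q y) + (1 - M%:R^-1).
(** [V a y] times the derivative of [ln] at [cond_mean y a], times the factor [1 / (M * Q y)] that
    turns deviations of the other words into deviations of the likelihood ratio. *)
Definition slope y a := V a y / cond_mean y a / (M%:R * Q y).

Lemma cond_mean_gt0 y a : 0 < V a y -> 0 < Q y -> 0 < cond_mean y a.
Proof.
by move=> Va Qy; rewrite /cond_mean ltr_pwDl ?subr_ge0// divr_gt0// mulr_gt0.
Qed.

(* The tangent of [ln] at [cond_mean] replaces conditional Jensen: its linear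
   part has mean zero since distinct code words are independent. *)
Lemma KL_term_le (c : {ffun 'I_M -> A}) y : 0 < ext_dist q M c ->
  (if avg M (V^~ y) c == 0 then 0
   else avg M (V^~ y) c * ln (avg M (V^~ y) c / Q y)) <=
  M%:R^-1 * \sum_i (V (c i) y * ln (cond_mean y (c i))
    + slope y (c i) * \sum_(j | j != i) (V (c j) y - Q y)).
Proof.
move=> wc; case: ifPn => [/eqP|] P0.
  have Vi0 i : V (c i) y = 0.
    move/eqP: P0; rewrite /avg mulf_eq0 invr_eq0 (gt_eqF MR0)/= => /eqP P0.
    exact: (psumr_eq0P _ P0).
  by rewrite big1 ?mulr0// => i _; rewrite /slope Vi0 !mul0r addr0.
have Pge0 : 0 <= avg M (V^~ y) c by rewrite mulr_ge0 ?invr_ge0 ?sumr_ge0.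
have Pgt0 : 0 < avg M (V^~ y) c by rewrite lt0r P0.
have Qy : 0 < Q y.
  have [i Vi] : exists i, 0 < V (c i) y.
    apply: contrapT => /forallNP h; move/eqP: P0; apply; rewrite /avg big1 ?mulr0// => i _.
    by apply/eqP; rewrite eq_le V0 andbT leNgt; apply/negP; exact: h.
  exact: (out_dist_gt0 _ _ Vc qd (c i)) (ext_dist_gt0_coord _ _ qd c i wc) Vi.
set z := avg M (V^~ y) c / Q y.
have z0 : 0 < z by rewrite divr_gt0.
rewrite {1}/avg -mulrA ler_pM2l ?invr_gt0// mulr_suml.
apply: ler_sum => i _.
have [Vi|Vi] := eqVneq (V (c i) y) 0; first by rewrite /slope Vi !mul0r addr0.
have Vp : 0 < V (c i) y by rewrite lt0r Vi V0.
have cm := cond_mean_gt0 _ _ Vp Qy.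
have -> : slope y (c i) * \sum_(j | j != i) (V (c j) y - Q y) =
    V (c i) y * (z / cond_mean y (c i) - 1).
  (* Word [i] contributes the same to both sides; the other [M - 1] words, centred at [Q y], account
     for the constant [1 - 1/M]. *)
  have zE : z - cond_mean y (c i) =
      (\sum_(j | j != i) (V (c j) y - Q y)) / (M%:R * Q y).
    rewrite sumrB sumr_const cardC1 card_ord /z /avg (bigD1 i)//= /cond_mean.
    have -> : Q y *+ M.-1 = (M%:R - 1) * Q y.
      by rewrite -(prednK M0) -natr1 addrK mulr_natl.
    by field; rewrite !gt_eqF.
  rewrite /slope -[X in _ - X](divff (lt0r_neq0 cm)) -mulrBl zE; ring.
rewrite -mulrDr ler_pM2l// -lerBlDl -ln_div ?posrE//.
by have := @le_ln1Dx _ (z / cond_mean y (c i) - 1); rewrite subrKC; apply;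
  rewrite ltrBrDl subrr divr_gt0.
Qed.

(** The linear terms have mean zero and the [M] equal remaining terms absorb [1/M]. What is left is
    the mean of [V * ln cond_mean], where [cond_mean <= 1 + V / (M * Q)]. *)
Lemma expect_KL_le s : 0 < s <= 1 ->
  expect q M (fun c => \sum_y if avg M (V^~ y) c == 0 then 0
     else avg M (V^~ y) c * ln (avg M (V^~ y) c / Q y))
  <= s^-1 * (Psi V q s * M%:R `^ (- s)).
Proof.
move=> s01; have [s0 s1] := andP s01.
apply: le_trans (le_expect q M qd _ _ (fun c wc => ler_sum _ (fun y _ => KL_term_le c y wc))) _.
rewrite expect_sum PsiE mulr_suml mulr_sumr; apply: ler_sum => y _.
rewrite expectZ expect_sum.
under eq_bigr => i _.
  rewrite expectD (expect_coord _ _ qd i (fun a => V a y * ln (cond_mean y a))).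
  under [X in _ + X]eq_expect do rewrite mulr_sumr.
  rewrite expect_sum [X in _ + X]big1 ?addr0; last first.
    move=> j ji; rewrite (expect_coord2 _ _ qd i j _ (fun a => V a y - Q y)) 1?eq_sym//.
    under [X in _ * X]eq_bigr do rewrite mulrBr.
    by rewrite sumrB -mulr_suml qd.2 mul1r subrr mulr0.
  over.
rewrite sumr_const card_ord -[X in _ * X]mulr_natl mulKf ?gt_eqF//.
rewrite mulr_suml mulr_suml mulr_sumr; apply: ler_sum => a _.
have := q0 a; rewrite le_eqVlt => /predU1P[<-|qa]; first by rewrite !mul0r mulr0.
have := V0 a y; rewrite le_eqVlt => /predU1P[<-|Va].
  by rewrite mul0r mulr0 !mulr_ge0 ?invr_ge0 ?(ltW s0) ?(ltW qa) ?powR_ge0.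
have Qy := out_dist_gt0 _ _ Vc qd _ _ qa Va.
rewrite -!mulrA [leRHS]mulrCA ler_pM2l//.
have -> : s^-1 * (V a y `^ (1 + s) * (Q y `^ (- s) * M%:R `^ (- s))) =
    V a y * (s^-1 * (V a y / (M%:R * Q y)) `^ s).
  rewrite powRD; last by rewrite (gt_eqF Va) implybT.
  rewrite powRr1// powRM ?invr_ge0 ?mulr_ge0 ?(ltW Qy) ?(ltW MR0)//.
  rewrite -(powR_inv1 (mulr_ge0 (ltW MR0) (ltW Qy))) -powRrM mulN1r.
  by rewrite powRM ?(ltW Qy) ?(ltW MR0)//; ring.
have u0 : 0 <= V a y / (M%:R * Q y) by rewrite divr_ge0// mulr_ge0 ?ltW.
rewrite ler_pM2l//; apply: le_trans (ln1D_le_powR _ _ s01 u0).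
rewrite ler_ln ?posrE ?cond_mean_gt0//; last by rewrite ltr_pwDl.
by rewrite /cond_mean addrC lerD2r gerBl invr_ge0.
Qed.

Lemma exists_code_D s : 0 < s <= 1 ->
  exists c : seq A, size c = M /\
    (D_code V q c <= (s^-1 * (Psi V q s * M%:R `^ (- s)))%:E)%E.
Proof.
move=> s01.
have [c wc h] := expect_attained q M qd (fun c => \sum_y if avg M (V^~ y) c == 0 then 0
     else avg M (V^~ y) c * ln (avg M (V^~ y) c / Q y)).
exists (codom c); split; first by rewrite size_codom card_ord.
(* The infinite branch is excluded: every code word has positive [q]-mass, so [Q y = 0] forces the
   code output to vanish at [y]. *)
rewrite /D_code /KL ifF; last first.
  apply/negbTE/existsPn => y; rewrite negb_and negbK orbC.
  case: (eqVneq (Q y) 0) => //= Q0; rewrite code_out_codom /avg big1 ?mulr0// => i _.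
  apply/eqP; rewrite eq_le V0 andbT leNgt; apply/negP => Vi.
  have := out_dist_gt0 _ _ Vc qd _ _ (ext_dist_gt0_coord _ _ qd c i wc) Vi.
  by rewrite Q0 ltxx.
under eq_bigr do rewrite code_out_codom.
by rewrite lee_fin; apply: le_trans h (expect_KL_le s s01).
Qed.

End OneShotDivergence.

(** * Upper bounds on [Psi] by sums of Gallager type *)

Section PsiBounds.
Context {R : realType} {A B : finType}.
Variables (V : A -> B -> R) (q : A -> R).
Hypotheses (Vc : is_channel V) (qd : is_dist q).

Let q0 a : 0 <= q a. Proof. exact: qd.1. Qed.
Let V0 a b : 0 <= V a b. Proof. exact: (Vc a).1. Qed.
Local Notation Q := (out_dist V q).

Lemma is_dist_le1 (C : finType) (p : C -> R) c : is_dist p -> p c <= 1.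
Proof. by move=> [p0 <-]; rewrite (bigD1 c)//= lerDl sumr_ge0. Qed.

Lemma channel_powR_le a b u : 1 <= u -> V a b `^ u <= V a b.
Proof.
move=> u1; have := V0 a b; rewrite le_eqVlt => /predU1P[<-|Va].
  by rewrite powR0// gt_eqF//; lra.
by rewrite ge1r_powR// Va is_dist_le1//; exact: Vc.
Qed.

(** Hoelder over [x] for each [y]: [q * V^(1+s)] is [(q * V^(1/(1-s)))^(1-s)] times [(q * V)^s], and
    the second factor sums to [Q], whose power cancels [Q^(-s)]. With [t = - s] the right side is
    the argument of the logarithm in [phi]. *)
Lemma Psi_le_gallager s : 0 < s < 1 ->
  Psi V q s <= \sum_y (\sum_x q x * V x y `^ (1 - s)^-1) `^ (1 - s).
Proof.
move=> /andP[s0 s1]; rewrite PsiE; apply: ler_sum => y _.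
have s1' : 0 < 1 - s by lra.
have := out_dist_ge0 V q Vc qd y; rewrite le_eqVlt => /predU1P[<-|Qy].
  by rewrite powR0 ?mulr0 ?powR_ge0// oppr_eq0 gt_eqF.
rewrite powRN ler_pdivrMr ?powR_gt0//.
have := @sum_hoelder R A (fun x => q x * V x y `^ (1 - s)^-1)
  (fun x => q x * V x y) (1 - s).
rewrite subKr; set lhs := (X in _ -> _ -> _ -> X <= _) => h.
suff -> : \sum_x q x * V x y `^ (1 + s) = lhs.
  by apply: h => [|x|x]; rewrite ?mulr_ge0 ?powR_ge0//; lra.
apply: eq_bigr => x _.
rewrite !powRM ?powR_ge0// -powRrM mulVf ?gt_eqF// mulrACA -powRD; last by rewrite subrK oner_eq0.
by rewrite subrK -powRD ?powRr1//; apply/implyP => /eqP; lra.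
Qed.

(** Since [V <= 1], the inner sum [a] is at most [Q y], so [Q^(-s)] may be replaced by [a^(-s)]. *)
Lemma Psi_le_powR s : 0 <= s <= 1 ->
  Psi V q s <= \sum_y (\sum_x q x * V x y `^ (1 + s)) `^ (1 - s).
Proof.
move=> /andP[s0 s1]; rewrite PsiE; apply: ler_sum => y _.
set a := \sum_x _.
have a0 : 0 <= a by rewrite sumr_ge0// => x _; rewrite mulr_ge0 ?powR_ge0.
have [->|an0] := eqVneq a 0; first by rewrite mul0r powR_ge0.
have ap : 0 < a by rewrite lt0r an0.
have aQ : a <= Q y.
  by apply: ler_sum => x _; rewrite ler_wpM2l// channel_powR_le//; lra.
have Qp : 0 < Q y by exact: lt_le_trans aQ.
rewrite powRD; last by rewrite an0 implybT.
rewrite powRr1// ler_wpM2l// !powRN lef_pV2 ?posrE ?powR_gt0//.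
exact: powR_le.
Qed.

(** Since [V <= 1], the inner sum is at most [Q y]; Hoelder against the constant 1 then gives the
    cardinality. *)
Lemma gallager_le_card s : 0 <= s < 1 ->
  \sum_y (\sum_x q x * V x y `^ (1 - s)^-1) `^ (1 - s) <= #|B|%:R `^ s.
Proof.
move=> /andP[s0 s1]; have s1' : 0 < 1 - s by lra.
apply: (@le_trans _ _ (\sum_y Q y `^ (1 - s) * 1 `^ (1 - (1 - s)))).
  apply: ler_sum => y _; rewrite powR1 mulr1; apply: powR_le; first exact: ltW.
    by rewrite sumr_ge0// => x _; rewrite mulr_ge0 ?powR_ge0.
  apply: ler_sum => x _; rewrite ler_wpM2l// channel_powR_le// invf_ge1//; lra.
have := @sum_hoelder R B Q (fun=> 1) (1 - s).
rewrite sum_out_dist// powR1 mul1r sumr_const subKr; apply => //; first by lra.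
by move=> y; exact: out_dist_ge0.
Qed.

End PsiBounds.

(** * Behaviour under memoryless extension *)

Section Tensorization.
Context {R : realType} {X Y : finType}.
Variables (W : X -> Y -> R) (p : X -> R).
Hypotheses (Wc : is_channel W) (pd : is_dist p).

Let p0 x : 0 <= p x. Proof. exact: pd.1. Qed.
Let W0 x y : 0 <= W x y. Proof. exact: (Wc x).1. Qed.

Lemma is_channel_ext n : is_channel (ext_chan W n).
Proof.
move=> x; split => [y|]; first exact: prodr_ge0.
rewrite /ext_chan -(bigA_distr_bigA (fun i y => W (x i) y)) big1// => i _.
exact: (Wc _).2.
Qed.

Lemma out_dist_ext n y :
  out_dist (ext_chan W n) (ext_dist p n) y = \prod_(i < n) out_dist W p (y i).
Proof.
rewrite /out_dist bigA_distr_bigA/=; apply: eq_bigr => x _.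
by rewrite -big_split.
Qed.

Lemma Psi_ext n s : Psi (ext_chan W n) (ext_dist p n) s = Psi W p s ^+ n.
Proof.
pose G y := (\sum_x p x * W x y `^ (1 + s)) * out_dist W p y `^ (- s).
rewrite !PsiE -/(G _) -[n in _ ^+ n]card_ord -prodr_const bigA_distr_bigA/=.
apply: eq_bigr => y _; rewrite big_split/=; congr (_ * _).
  rewrite bigA_distr_bigA/=; apply: eq_bigr => x _.
  by rewrite /ext_chan powR_prod// -big_split.
by rewrite out_dist_ext powR_prod// => i; exact: out_dist_ge0.
Qed.

(** The function [oapp g z (unlift ord0 i)] of [i] is the word with first letter [z] and tail
    [g]. *)
Lemma sum_ffun_recl (Z : finType) n (F : {ffun 'I_n.+1 -> Z} -> R) :
  \sum_f F f = \sum_z \sum_(g : {ffun 'I_n -> Z})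
     F [ffun i => oapp g z (unlift ord0 i)].
Proof.
rewrite pair_big/=.
pose h (zg : Z * {ffun 'I_n -> Z}) : {ffun 'I_n.+1 -> Z} :=
  [ffun i => oapp zg.2 zg.1 (unlift ord0 i)].
pose k (f : {ffun 'I_n.+1 -> Z}) := (f ord0, [ffun j => f (lift ord0 j)]).
rewrite (reindex h)//=; apply: onW_bij; exists k.
- move=> [z g]; rewrite /k /h/=; congr (_, _).
    by rewrite ffunE unlift_none.
  by apply/ffunP => j; rewrite !ffunE liftK.
- move=> f; apply/ffunP => i; rewrite ffunE.
  by case: unliftP => [j ->|->] /=; rewrite ?ffunE.
Qed.

Lemma prod_ffun_recl (Z T : finType) n (f : Z -> T -> R) z t
    (g : {ffun 'I_n -> Z}) (h : {ffun 'I_n -> T}) :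
  \prod_(i < n.+1) f ([ffun i => oapp g z (unlift ord0 i)] i)
     ([ffun i => oapp h t (unlift ord0 i)] i) = f z t * \prod_i f (g i) (h i).
Proof.
rewrite big_ord_recl !ffunE unlift_none/=; congr (_ * _).
by apply: eq_bigr => i _; rewrite !ffunE liftK.
Qed.

Lemma sum_powR_homogeneous (f : X -> Y -> R) th kappa : 0 <= th ->
  (forall x y, 0 <= f x y) ->
  (forall q, is_dist q -> \sum_y (\sum_x q x * f x y) `^ th <= kappa) ->
  forall q, (forall x, 0 <= q x) ->
  \sum_y (\sum_x q x * f x y) `^ th <= kappa * (\sum_x q x) `^ th.
Proof.
move=> th0 f0 H q q0.
have S0 : 0 <= \sum_x q x by exact: sumr_ge0.
have [Sq|Sn0] := eqVneq (\sum_x q x) 0.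
  have e y : \sum_x q x * f x y = 0.
    by rewrite big1// => x _; rewrite (psumr_eq0P _ Sq)// mul0r.
  under eq_bigr do rewrite e.
  (* With [th = 0] (that is, [s = 1]) the convention [0^0 = 1] makes the left side the cardinality
     of [Y], which the hypothesis at [p] bounds by [kappa]. *)
  rewrite Sq; have [th00|thn0] := eqVneq th 0; last first.
    by rewrite powR0// mulr0 big1.
  have := H p pd; rewrite th00 !powRr0 mulr1; apply: le_trans.
  by apply: ler_sum => y _; rewrite !powRr0.
have Sp : 0 < \sum_x q x by rewrite lt0r Sn0.
set S := \sum_x q x in S0 Sn0 Sp *.
have -> : \sum_y (\sum_x q x * f x y) `^ th =
    (\sum_y (\sum_x (q x / S) * f x y) `^ th) * S `^ th.
  rewrite mulr_suml; apply: eq_bigr => y _; rewrite -powRM//; last first.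
    by apply: sumr_ge0 => x _; rewrite mulr_ge0// divr_ge0.
  congr (_ `^ _); rewrite mulr_suml; apply: eq_bigr => x _.
  by rewrite mulrAC divfK.
rewrite ler_wpM2r ?powR_ge0//; apply: H; split => [x|]; first by rewrite divr_ge0.
by rewrite -mulr_suml divff.
Qed.

(* Multiplicativity over product channels: sum out one letter at a time, using
   homogeneity to apply the single-letter bound to an unnormalized input. *)
Lemma sum_powR_ext_le (f : X -> Y -> R) th kappa : 0 <= th ->
  (forall x y, 0 <= f x y) ->
  (forall q, is_dist q -> \sum_y (\sum_x q x * f x y) `^ th <= kappa) ->
  forall n (q : {ffun 'I_n -> X} -> R), (forall x, 0 <= q x) ->
  \sum_(y : {ffun 'I_n -> Y}) (\sum_x q x * \prod_i f (x i) (y i)) `^ th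
    <= kappa ^+ n * (\sum_x q x) `^ th.
Proof.
move=> th0 f0 H.
have k0 : 0 <= kappa.
  by apply: le_trans (H p pd); apply: sumr_ge0 => y _; exact: powR_ge0.
elim=> [|n IH] q q0.
  under eq_bigr => y _.
    under eq_bigr do rewrite big_ord0 mulr1.
    over.
  by rewrite sumr_const card_ffun card_ord expn0 expr0 mul1r mulr1n.
rewrite [leLHS]sum_ffun_recl.
(* For a fixed first output [y0], the first input letter is summed into an unnormalized input on the
   remaining letters. *)
pose q' y0 (x : {ffun 'I_n -> X}) :=
  \sum_x0 q [ffun i => oapp x x0 (unlift ord0 i)] * f x0 y0.
apply: (@le_trans _ _ (\sum_y0 kappa ^+ n * (\sum_x q' y0 x) `^ th)).
  apply: ler_sum => y0 _; apply: le_trans (IH (q' y0) _); last first.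
    by move=> x; apply: sumr_ge0 => x0 _; rewrite mulr_ge0.
  rewrite le_eqVlt; apply/orP; left; apply/eqP; apply: eq_bigr => y _.
  congr (_ `^ _); rewrite [LHS]sum_ffun_recl exchange_big/=; apply: eq_bigr => x _.
  rewrite /q' mulr_suml; apply: eq_bigr => x0 _.
  by rewrite prod_ffun_recl mulrA.
rewrite -mulr_sumr exprSr -mulrA ler_wpM2l ?exprn_ge0//.
rewrite [in leRHS]sum_ffun_recl.
(* What remains is a single-letter sum whose input is the first-letter marginal of [q]. *)
apply: le_trans (sum_powR_homogeneous f th kappa th0 f0 H _ _).
  rewrite le_eqVlt; apply/orP; left; apply/eqP; apply: eq_bigr => y _.
  congr (_ `^ _); rewrite /q' exchange_big/=; apply: eq_bigr => x0 _.
  by rewrite mulr_suml.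
by move=> x; exact: sumr_ge0.
Qed.

Lemma sum_powR_ext_chan_le u th kappa : 0 <= th ->
  (forall q, is_dist q -> \sum_y (\sum_x q x * W x y `^ u) `^ th <= kappa) ->
  forall n (q : {ffun 'I_n -> X} -> R), is_dist q ->
  \sum_y (\sum_x q x * ext_chan W n x y `^ u) `^ th <= kappa ^+ n.
Proof.
move=> th0 H n q qd.
have := sum_powR_ext_le (fun x y => W x y `^ u) th kappa th0
  (fun x y => powR_ge0 _ _) H n q qd.1.
rewrite qd.2 powR1 mulr1; apply: le_trans.
rewrite le_eqVlt; apply/orP; left; apply/eqP; apply: eq_bigr => y _.
by congr (_ `^ _); apply: eq_bigr => x _; rewrite /ext_chan powR_prod.
Qed.

End Tensorization.

(** * From finite-length bounds to exponents *)

Section Exponents.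
Context {R : realType}.

Lemma neglog_ge (x : \bar R) (C : R) : 0 < C -> (x <= C%:E)%E ->
  ((- ln C)%:E <= neglog x)%E.
Proof.
move=> C0; case: x => [r||] //=; last by rewrite leey.
rewrite lee_fin => rC; case: ifPn; first by rewrite leey.
rewrite -ltNge => r0; rewrite lee_fin lerN2 ler_ln// posrE.
Qed.

Lemma le_limn_einf (u : nat -> \bar R) (E : R) :
  (forall e, 0 < e -> exists N, forall n, (N <= n)%N -> ((E - e)%:E <= u n)%E) ->
  (E%:E <= limn_einf u)%E.
Proof.
move=> H; rewrite limn_einf_lim (cvg_lim _ (@cvg_einfs_sup _ u))//.
apply/lee_addgt0Pr => e /H[N HN].
rewrite -leeBlDr// -EFinB.
apply: (@le_trans _ _ (einfs u N)); last by apply: ereal_sup_ubound; exists N.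
by apply: le_ereal_inf_tmp => _ [n /= Nn <-]; exact: HN.
Qed.

Lemma limn_esup_le (u : nat -> \bar R) (l : \bar R) :
  (forall n, (u n <= l)%E) -> (limn_esup u <= l)%E.
Proof.
move=> H; rewrite limn_esup_lim (cvg_lim _ (@cvg_esups_inf _ u))//.
apply: (@le_trans _ _ (esups u 0)); first by apply: ereal_inf_lbound; exists 0.
by apply: ge_ereal_sup => _ [n /= _ <-]; exact: H.
Qed.

Lemma le_limn_einf_neglog (x : nat -> \bar R) (E C : R) : 0 < C ->
  (forall n, (x n <= (C * expR (- (n%:R * E)))%:E)%E) ->
  (E%:E <= limn_einf (fun n => ((n%:R^-1)%:E * neglog (x n))%E))%E.
Proof.
move=> C0 H; apply: le_limn_einf => e e0.
(* From this index on, the prefactor costs [|ln C| / n <= e]; the successor also ensures [n > 0]. *)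
exists (Num.trunc (`|ln C| / e)).+1 => n Nn.
have n0 : 0 < n%:R :> R by rewrite ltr0n (leq_trans _ Nn).
have ne : `|ln C| <= n%:R * e.
  rewrite -ler_pdivrMr//.
  have /andP[_ /ltW h] := truncn_itv (divr_ge0 (normr_ge0 (ln C)) (ltW e0)).
  by apply: le_trans h _; rewrite ler_nat.
have B0 : 0 < C * expR (- (n%:R * E)) by rewrite mulr_gt0 ?expR_gt0.
have := neglog_ge _ _ B0 (H n).
rewrite lnM ?posrE ?expR_gt0// expRK => h.
apply: le_trans (lee_wpmul2l _ h); last by rewrite lee_fin invr_ge0 ltW.
rewrite -EFinM lee_fin -ler_pdivrMl ?invr_gt0// invrK.
have := le_trans (ler_norm _) ne; lra.
Qed.

Lemma truncn_expR_gt0 (r : R) : 0 <= r -> (0 < Num.trunc (expR r))%N.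
Proof.
by move=> r0; rewrite truncn_gt_nat -expR0 ler_expR.
Qed.

(** Rounding costs at most a factor 2: the integer part [M] of [expR r] is at least 1, so
    [expR r < M + 1 <= 2 * M], and [2^u <= 2]. *)
Lemma truncn_expR_powRN (r u : R) : 0 <= r -> 0 <= u <= 1 ->
  (Num.trunc (expR r))%:R `^ (- u) <= 2 * expR (- (r * u)).
Proof.
move=> r0 /andP[u0 u1]; set M := Num.trunc _.
have M0 : (0 < M)%N by exact: truncn_expR_gt0.
have /andP[_ h] := truncn_itv (expR_ge0 r).
have h2 : expR r / 2 <= M%:R.
  rewrite ler_pdivrMr// -natrM muln2 -addnn.
  by apply: le_trans (ltW h) _; rewrite ler_nat -add1n leq_add2r.
have e0 : 0 < expR r / 2 by rewrite divr_gt0 ?expR_gt0.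
apply: (@le_trans _ _ ((expR r / 2) `^ (- u))).
  rewrite !powRN lef_pV2 ?posrE ?powR_gt0 ?ltr0n//.
  by apply: powR_le => //; exact: ltW.
rewrite powRM ?expR_ge0// mulrC -expRM mulrN -(powR_inv1 (ler0n _ 2)) -powRrM mulrNN mul1r.
rewrite ler_wpM2r ?expR_ge0//.
by rewrite -[leRHS]powRr1// ler_powR// ler1n.
Qed.

End Exponents.

(** * Codes for the extended channel and the resulting exponents *)

Section Achievability.
Context {R : realType} {X Y : finType}.
Variables (W : X -> Y -> R) (r : R).
Hypotheses (Wc : is_channel W) (r0 : 0 <= r).

Let rate_ge0 n : 0 <= n%:R * r. Proof. by rewrite mulr_ge0. Qed.
Local Notation M n := (Num.trunc (expR (n%:R * r))).

(** The factor 6 is the 3 of the one-shot bound times the 2 lost in rounding the code size. *)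
Lemma ext_code_eps n (q : {ffun 'I_n -> X} -> R) s l : is_dist q -> 0 <= s <= 1 ->
  Psi (ext_chan W n) q s <= expR (n%:R * l) ->
  exists c : seq {ffun 'I_n -> X}, size c = M n /\
    eps_code (ext_chan W n) q c <= 6 * expR (- (n%:R * ((- l + s * r) / (1 + s)))).
Proof.
move=> qd s01 hP; have [s0 s1] := andP s01.
have Vc := is_channel_ext W Wc n.
have [c [cM ce]] := exists_code_eps _ q _ Vc qd (truncn_expR_gt0 _ (rate_ge0 n)) s s01.
exists c; split => //; apply: le_trans ce _.
have sp : 0 < 1 + s by lra.
have hP' : Psi (ext_chan W n) q s `^ (1 + s)^-1 <= expR (n%:R * l / (1 + s)).
  by rewrite expRM; apply: powR_le => //; rewrite ?invr_ge0 ?(ltW sp)// Psi_ge0.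
have u01 : 0 <= s / (1 + s) <= 1.
  by rewrite divr_ge0 ?(ltW sp)//= ler_pdivrMr//; lra.
have hM := truncn_expR_powRN _ _ (rate_ge0 n) u01.
have -> : 6 * expR (- (n%:R * ((- l + s * r) / (1 + s)))) =
    3 * (expR (n%:R * l / (1 + s)) * (2 * expR (- (n%:R * r * (s / (1 + s)))))).
  rewrite [X in 3 * X]mulrCA -expRD [RHS]mulrA; congr (_ * expR _); [ring | field; lra].
by rewrite ler_pM2l// ler_pM ?powR_ge0.
Qed.

Lemma ext_code_D n (q : {ffun 'I_n -> X} -> R) s l : is_dist q -> 0 < s <= 1 ->
  Psi (ext_chan W n) q s <= expR (n%:R * l) ->
  exists c : seq {ffun 'I_n -> X}, size c = M n /\
    (D_code (ext_chan W n) q c <= (2 / s * expR (- (n%:R * (- l + s * r))))%:E)%E.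
Proof.
move=> qd s01 hP; have [s0 s1] := andP s01.
have Vc := is_channel_ext W Wc n.
have [c [cM ce]] := exists_code_D _ q _ Vc qd (truncn_expR_gt0 _ (rate_ge0 n)) s s01.
exists c; split => //; apply: le_trans ce _; rewrite lee_fin.
have s01' : 0 <= s <= 1 by rewrite s1 ltW.
have hM := truncn_expR_powRN _ _ (rate_ge0 n) s01'.
have -> : 2 / s * expR (- (n%:R * (- l + s * r))) =
    s^-1 * (expR (n%:R * l) * (2 * expR (- (n%:R * r * s)))).
  by rewrite [X in s^-1 * X]mulrCA -expRD [RHS]mulrA [_ * 2]mulrC; congr (_ * expR _); ring.
by rewrite ler_pM2l ?invr_gt0// ler_pM ?powR_ge0// Psi_ge0.
Qed.

Lemma rate_ok_truncn (c : forall n : nat, seq {ffun 'I_n -> X}) :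
  (forall n, size (c n) = M n) -> rate_ok c r.
Proof.
move=> cM; split => [n|]; first by rewrite cM truncn_expR_gt0.
apply: limn_esup_le => n; rewrite lee_fin cM.
have M0 : 0 < (M n)%:R :> R by rewrite ltr0n truncn_expR_gt0.
have [->|n0] := posnP n; first by rewrite invr0 mul0r.
rewrite ler_pdivrMl ?ltr0n// -[leRHS]expRK ler_ln ?posrE ?expR_gt0//.
by rewrite truncn_le expR_ge0.
Qed.

Lemma codes_le_truncn n (c : seq {ffun 'I_n -> X}) : size c = M n ->
  codes_le {ffun 'I_n -> X} (expR (n%:R * r)) c.
Proof.
by move=> cM; rewrite /codes_le /= cM truncn_expR_gt0// truncn_le expR_ge0.
Qed.

Lemma le_e_eps_p p s l : is_dist p -> 0 <= s <= 1 ->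
  (forall n, Psi (ext_chan W n) (ext_dist p n) s <= expR (n%:R * l)) ->
  (((- l + s * r) / (1 + s))%:E <= e_eps_p W p r)%E.
Proof.
move=> pd s01 hP.
have H n := cid (ext_code_eps n _ s l (is_dist_ext_dist p n pd) s01 (hP n)).
apply: (@le_trans _ _ (limn_einf (fun n : nat => ((n%:R^-1)%:E *
    neglog (eps_code (ext_chan W n) (ext_dist p n) (sval (H n)))%:E)%E))).
  apply: (@le_limn_einf_neglog _ _ _ 6) => // n.
  by rewrite lee_fin; case: (svalP (H n)).
apply: ereal_sup_ubound; exists (fun n => sval (H n)); split => //.
by apply: rate_ok_truncn => n; case: (svalP (H n)).
Qed.

Lemma le_e_D_p p s l : is_dist p -> 0 < s <= 1 ->
  (forall n, Psi (ext_chan W n) (ext_dist p n) s <= expR (n%:R * l)) ->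
  ((- l + s * r)%:E <= e_D_p W p r)%E.
Proof.
move=> pd s01 hP; have [s0 s1] := andP s01.
have H n := cid (ext_code_D n _ s l (is_dist_ext_dist p n pd) s01 (hP n)).
apply: (@le_trans _ _ (limn_einf (fun n : nat => ((n%:R^-1)%:E *
    neglog (D_code (ext_chan W n) (ext_dist p n) (sval (H n))))%E))).
  apply: (@le_limn_einf_neglog _ _ _ (2 / s)) => [|n]; first by rewrite divr_gt0.
  by case: (svalP (H n)).
apply: ereal_sup_ubound; exists (fun n => sval (H n)); split => //.
by apply: rate_ok_truncn => n; case: (svalP (H n)).
Qed.

Lemma le_e_eps s l : 0 <= s <= 1 ->
  (forall n (q : {ffun 'I_n -> X} -> R), is_dist q ->
     Psi (ext_chan W n) q s <= expR (n%:R * l)) ->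
  (((- l + s * r) / (1 + s))%:E <= e_eps W r)%E.
Proof.
move=> s01 hP; apply: (@le_limn_einf_neglog _ _ _ 6) => // n.
apply: ge_ereal_sup => _ [q qd <-].
have [c [cM ce]] := ext_code_eps n q s l qd s01 (hP n q qd).
apply: (@le_trans _ _ (eps_code (ext_chan W n) q c)%:E); last by rewrite lee_fin.
by apply: ereal_inf_lbound; exists c => //; exact: codes_le_truncn.
Qed.

Lemma le_e_D s l : 0 < s <= 1 ->
  (forall n (q : {ffun 'I_n -> X} -> R), is_dist q ->
     Psi (ext_chan W n) q s <= expR (n%:R * l)) ->
  ((- l + s * r)%:E <= e_D W r)%E.
Proof.
move=> s01 hP; have [s0 s1] := andP s01.
apply: (@le_limn_einf_neglog _ _ _ (2 / s)) => [|n]; first by rewrite divr_gt0.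
apply: ge_ereal_sup => _ [q qd <-].
have [c [cM ce]] := ext_code_D n q s l qd s01 (hP n q qd).
apply: le_trans ce.
by apply: ereal_inf_lbound; exists c => //; exact: codes_le_truncn.
Qed.

Lemma exprn_le_expR_ln (x : R) n : 0 <= x -> x ^+ n <= expR (n%:R * ln x).
Proof. by move=> x0; rewrite expRM_natl lerXn2r ?nnegrE ?expR_ge0// le_expR_ln. Qed.

Lemma Psi_ext_gallager_le (p : X -> R) s l : is_dist p -> 0 < s < 1 ->
  (forall q : X -> R, is_dist q ->
     \sum_y (\sum_x q x * W x y `^ (1 - s)^-1) `^ (1 - s) <= expR l) ->
  forall n (q : {ffun 'I_n -> X} -> R), is_dist q ->
     Psi (ext_chan W n) q s <= expR (n%:R * l).
Proof.
move=> pd s01 H n q qd.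
apply: le_trans (Psi_le_gallager _ _ (is_channel_ext W Wc n) qd s s01) _.
rewrite expRM_natl; apply: (sum_powR_ext_chan_le W p Wc pd) => //; lra.
Qed.

Lemma gallager_le_expR (q : X -> R) s : is_dist q -> 0 <= s < 1 ->
  \sum_y (\sum_x q x * W x y `^ (1 - s)^-1) `^ (1 - s) <= expR (s * ln #|Y|%:R).
Proof.
move=> qd s01; apply: le_trans (gallager_le_card W q Wc qd s s01) _.
by rewrite -ln_powR le_expR_ln.
Qed.

(** A real [sup] dominates only the elements of a bounded set; the bound comes from
    [gallager_le_card] and [ln k <= k]. *)
Lemma phi_le_max_phi t (p : X -> R) : - 2^-1 <= t <= 0 -> is_dist p -> phi t W p <= max_phi t W.
Proof.
move=> t01 pd; apply: ub_le_sup; last by exists p.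
exists (#|Y|%:R `^ (- t)) => _ [q qd <-].
have := gallager_le_card W q Wc qd (- t); rewrite opprK => /(_ ltac:(lra)).
apply: le_trans; rewrite /phi; set k := \sum_y _.
have := @sumr_ge0 R Y (index_enum Y) xpredT (fun y => (\sum_x q x * W x y `^ (1 + t)^-1) `^ (1 + t)).
move=> /(_ (fun y _ => powR_ge0 _ _)); rewrite -/k le_eqVlt => /predU1P[<-|k0].
  by rewrite ln0.
exact: ltW (ln_sublinear k0).
Qed.

(** The set is bounded because each of its [#|Y|] summands is at most 1. *)
Lemma sum_powR_le_psi s (p : X -> R) : 0 <= s <= 1 -> is_dist p ->
  \sum_y (\sum_x p x * W x y `^ (1 + s)) `^ (1 - s) <=
  sup [set \sum_y (\sum_x p x * W x y `^ (1 + s)) `^ (1 - s)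
          | p in [set p : X -> R | is_dist p]].
Proof.
move=> /andP[s0 s1] pd; apply: ub_le_sup; last by exists p.
exists #|Y|%:R => _ [q qd <-].
rewrite -sumr_const; apply: ler_sum => y _.
apply: (@le_trans _ _ (1 `^ (1 - s))); last by rewrite powR1.
apply: powR_le; first lra.
  by apply: sumr_ge0 => x _; rewrite mulr_ge0 ?powR_ge0//; exact: qd.1.
rewrite -[leRHS]qd.2; apply: ler_sum => x _; rewrite ler_piMr//; first exact: qd.1.
apply: le_trans (channel_powR_le W Wc x y (1 + s) _) _; first lra.
by apply: is_dist_le1; exact: Wc.
Qed.

End Achievability.

Theorem theorem10 (R : realType) (X Y : finType) (W : X -> Y -> R) (p : X -> R) (r : R) :
  is_channel W -> is_dist p -> 0 <= r ->
  [/\ (ereal_sup [set EFin ((- psi_p s W p + s * r) / (1 + s))%R | s in [set s : R | (0 <= s <= 1)%R]]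
         <= e_eps_p W p r)%E,
      (ereal_sup [set EFin (- phi t W p - t * r)%R | t in [set t : R | (- 2^-1 <= t <= 0)%R]]
         <= e_D_p W p r)%E,
      (ereal_sup [set EFin ((- psi s W + s * r) / (1 + s))%R | s in [set s : R | (0 <= s <= 1)%R]]
         <= e_eps W r)%E
    & (ereal_sup [set EFin (- max_phi t W - t * r)%R | t in [set t : R | (- 2^-1 <= t <= 0)%R]]
         <= e_D W r)%E].
Proof.
move=> Wc pd r0.
have PsiX n s : Psi (ext_chan W n) (ext_dist p n) s <= expR (n%:R * psi_p s W p).
  by rewrite (Psi_ext W p Wc pd) exprn_le_expR_ln// Psi_ge0.
have phi0 : phi 0 W p = 0.
  rewrite /phi; under eq_bigr => y _.
    under eq_bigr do rewrite addr0 invr1 powRr1 ?(Wc _).1//.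
    rewrite addr0 powRr1; last by apply: out_dist_ge0.
    over.
  by rewrite sum_out_dist// ln1.
(* The endpoint [t = 0]: the divergence bound carries [1/s], so [s = 0] is reached only as a limit
   of exponents with small [s > 0]. *)
have phi0_le (e : \bar R) :
    (forall s, 0 < s < 1 -> ((- (s * ln #|Y|%:R) + s * r)%:E <= e)%E) -> (0 <= e)%E.
  move=> H; apply/lee_addgt0Pr => d d0.
  (* The first entry keeps [s < 1], the second makes the loss [s * ln #|Y|] at most [d]. *)
  pose s := Num.min 2^-1 (d / (1 + ln #|Y|%:R)).
  have Y1 : 1 <= #|Y|%:R :> R.
    rewrite ler1n lt0n; apply/eqP => /card0_eq Y0.
    have : \sum_y out_dist W p y = 1 by rewrite sum_out_dist.
    rewrite big1 => [/eqP|y _]; first by rewrite eq_sym oner_eq0.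
    by have := Y0 y.
  have lnY : 0 <= ln #|Y|%:R :> R by rewrite ln_ge0.
  have s0 : 0 < s by rewrite lt_min invr_gt0 ltr0n divr_gt0//; lra.
  have s1 : s < 1 by rewrite gt_min; apply/orP; left; lra.
  have sd : s * (1 + ln #|Y|%:R) <= d.
    by rewrite -ler_pdivlMr ?ge_min ?lexx ?orbT//; lra.
  have := H s; rewrite s0 s1 => /(_ isT) h.
  rewrite -leeBlDr// sub0e; apply: le_trans h; rewrite -EFinN lee_fin.
  have := mulr_ge0 (ltW s0) r0; lra.
split.
- apply: ge_ereal_sup => _ [s s01 <-].
  by apply: le_e_eps_p => // n; exact: PsiX.
- apply: ge_ereal_sup => _ [t /= /andP[t1 tle0] <-].
  have [->|tn0] := eqVneq t 0.
    rewrite phi0 oppr0 mul0r subr0; apply: phi0_le => s s01.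
    have [s0 s1] := andP s01.
    apply: le_e_D_p => //; first by rewrite s0 ltW.
    move=> n; apply: (Psi_ext_gallager_le W Wc p) => //; last first.
      exact: is_dist_ext_dist.
    by move=> q qd; apply: gallager_le_expR => //; rewrite (ltW s0).
  have t0 : t < 0 by rewrite lt_neqAle tn0.
  (* The substitution is [s = - t], which lies between 0 and 1/2. *)
  rewrite -mulNr; apply: le_e_D_p => //; first by lra.
  move=> n; rewrite (Psi_ext W p Wc pd) expRM_natl.
  rewrite lerXn2r ?nnegrE ?expR_ge0 ?Psi_ge0//.
  apply: le_trans (le_expR_ln _).
  by have := Psi_le_gallager W p Wc pd (- t); rewrite opprK; apply; lra.
- apply: ge_ereal_sup => _ [s s01 <-].
  apply: le_e_eps => // n q qd.
  (* For an input that is not a product, [Psi] need not factorize; its dominating sum still obeys a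
     product bound. *)
  apply: le_trans (Psi_le_powR _ _ (is_channel_ext W Wc n) qd s s01) _.
  have s1 : 0 <= 1 - s by move: s01 => /=; lra.
  apply: le_trans (sum_powR_ext_chan_le W p Wc pd _ _ _ s1
    (fun q qd => sum_powR_le_psi W Wc s q s01 qd) n q qd) _.
  apply: exprn_le_expR_ln; apply: le_trans (sum_powR_le_psi W Wc s p s01 pd).
  by apply: sumr_ge0 => y _; exact: powR_ge0.
- apply: ge_ereal_sup => _ [t /= t01 <-]; have [t1 tle0] := andP t01.
  have [te|tn0] := eqVneq t 0.
    apply: (@le_trans _ _ 0%E).
      (* [max_phi] at 0 is at least [phi 0 W p = 0], so nonnegativity of the exponent suffices. *)
      rewrite te mul0r subr0 lee_fin oppr_le0 -[leLHS]phi0.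
      by apply: phi_le_max_phi => //; lra.
    apply: phi0_le => s s01; have [s0 s1] := andP s01.
    apply: le_e_D => //; first by rewrite s0 ltW.
    apply: (Psi_ext_gallager_le W Wc p) => // q qd.
    by apply: gallager_le_expR => //; rewrite (ltW s0).
  have t0 : t < 0 by rewrite lt_neqAle tn0.
  rewrite -mulNr; apply: le_e_D => //; first lra.
  apply: (Psi_ext_gallager_le W Wc p) => //; first lra.
  move=> q qd; rewrite opprK; apply: le_trans (le_expR_ln _) _.
  by rewrite ler_expR; exact: phi_le_max_phi.
Qed.
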